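(* Let $p$ be a prime, $G$ a finite $p$-group, $\mathbf{F}$ a field of characteristic $p$, and $V$ an $\mathbf{F}G$-module of finite dimension $n$. Choose a basis $\{x,y_1,\ldots,y_{n-1}\}$ of $V^*$ such that $x\in (V^* )^G$ and, for each $i$, the orbit $y_iG$ is contained in $\mathrm{Span}_{\mathbf{F}}\{x,y_j\mid j\le i\}$, and use the graded reverse lexicographic order on $\mathbf{F}[V]=\mathbf{F}[x,y_1,\ldots,y_{n-1}]$ with $x<y_1<\cdots<y_{n-1}$. Let $f_1,\ldots,f_\ell\in\mathbf{F}[V]^G$ be homogeneous with $\mathrm{LM}(f_i)\in\mathbf{F}[y_1,\ldots,y_{n-1}]$, put $\mathcal{B}=\{x,f_1,\ldots,f_\ell\}$ and let $A$ be the $\mathbf{F}$-algebra generated by $\mathcal{B}$. Suppose that $A[x^{-1}]=\mathbf{F}[V]^G[x^{-1}]$, that $\mathcal{B}$ is a SAGBI basis for $A$, and that $\mathbf{F}[V]^G$ is an integral extension of $A$. Then $A=\mathbf{F}[V]^G$ and $\mathcal{B}$ is a SAGBI basis for $\mathbf{F}[V]^G$.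
   Context: $V$ is a left $\mathbf{F}G$-module, $V^*$ is the dual right module, $\mathbf{F}[V]$ is the symmetric algebra on $V^*$ with $G$ acting by degree-preserving algebra automorphisms, and $\mathbf{F}[V]^G$ is the subring of invariants. $\mathrm{LM}(f)$ denotes the lead monomial of $f$. A subset $\mathcal{B}$ of a subalgebra $A$ of a polynomial ring is a SAGBI basis for $A$ if the lead monomials of the elements of $\mathcal{B}$ generate, as an algebra, the lead term algebra of $A$ (the algebra spanned by the lead monomials of the nonzero elements of $A$). *)

(* Defs.v *)
From HB Require Import structures.
From mathcomp Require Import all_boot all_order all_algebra.
From mathcomp Require Import all_fingroup all_solvable mxrepresentation.
From mathcomp Require Import fraction mpoly.

Set Implicit Arguments.
Unset Strict Implicit.
Unset Printing Implicit Defensive.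

Import GRing.Theory.

Local Open Scope ring_scope.

(* Graded reverse lexicographic order for 'X_0 < 'X_1 < ... < 'X_(n-1): in equal
   degrees, a < b iff a has the larger exponent at the smallest variable where a
   and b differ.  The order that mpoly.v puts on 'X_{1..n}, on which mlead is
   based, cannot be used: despite its documentation it is the graded
   lexicographic order with 'X_0 largest. *)
Definition grevlex_lt n (a b : 'X_{1..n}) : bool :=
  (mdeg a < mdeg b)%N ||
  (mdeg a == mdeg b) &&
  [exists i : 'I_n, (b i < a i)%N &&
                    [forall j : 'I_n, (j < i)%N ==> (a j == b j)]].

Definition grevlex_max n (a b : 'X_{1..n}) : 'X_{1..n} :=
  if grevlex_lt a b then b else a.

(* LM 0 is the junk value 0%MM. *)
Definition LM (F : fieldType) n (f : {mpoly F[n]}) : 'X_{1..n} :=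
  \big[@grevlex_max n/0%MM]_(m <- msupp f) m.

Lemma grevlex_lt_irr n (a : 'X_{1..n}) : grevlex_lt a a = false.
Proof.
rewrite /grevlex_lt ltnn eqxx /=; apply/existsP => -[i].
by rewrite ltnn.
Qed.

Lemma grevlex_lt_trans n (b a c : 'X_{1..n}) :
  grevlex_lt a b -> grevlex_lt b c -> grevlex_lt a c.
Proof.
rewrite /grevlex_lt => /orP[ab|/andP[/eqP -> /existsP[i /andP[iab /forallP eab]]]];
  move=> /orP[bc|/andP[/eqP ebc /existsP[j /andP[jbc /forallP fbc]]]].
- by rewrite (ltn_trans ab bc).
- by rewrite -ebc ab.
- by rewrite bc.
apply/orP; right; rewrite ebc eqxx /=; apply/existsP.
case: (ltngtP i j) => [ij|ji|/val_inj eij].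
- exists i; rewrite -(eqP (implyP (fbc i) ij)) iab /=.
  apply/forallP => k; apply/implyP => ki.
  by rewrite (eqP (implyP (eab k) ki)) (eqP (implyP (fbc k) (ltn_trans ki ij))).
- exists j; rewrite (eqP (implyP (eab j) ji)) jbc /=.
  apply/forallP => k; apply/implyP => kj.
  by rewrite (eqP (implyP (eab k) (ltn_trans kj ji))) (eqP (implyP (fbc k) kj)).
- rewrite -eij in jbc fbc; exists i; rewrite (ltn_trans jbc iab) /=.
  apply/forallP => k; apply/implyP => ki.
  by rewrite (eqP (implyP (eab k) ki)) (eqP (implyP (fbc k) ki)).
Qed.

Lemma grevlex_lt_total n (a b : 'X_{1..n}) :
  a != b -> grevlex_lt a b || grevlex_lt b a.
Proof.
move=> neq; rewrite /grevlex_lt; case: (ltngtP (mdeg a) (mdeg b)) => //= _.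
have [i neqi] : exists i, a i != b i.
  apply/existsP; apply: contraNT neq; rewrite negb_exists => /forallP h.
  by apply/eqP/mnmP => i; apply/eqP; have := h i; rewrite negbK.
have [k neqk kmin] := @arg_minnP _ i (fun i => a i != b i) val neqi.
have eqlt (j : 'I_n) : (j < k)%N -> a j = b j.
  by move=> jk; apply/eqP; apply: contraLR jk => /kmin; rewrite -leqNgt.
case: (ltngtP (b k) (a k)) => [lt|lt|eq].
- apply/orP; left; apply/existsP; exists k; rewrite lt /=.
  by apply/forallP => j; apply/implyP => /eqlt ->.
- apply/orP; right; apply/existsP; exists k; rewrite lt /=.
  by apply/forallP => j; apply/implyP => /eqlt ->.
- by rewrite eq eqxx in neqk.
Qed.

Lemma LM_max (F : fieldType) n (f : {mpoly F[n]}) : f != 0 ->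
  LM f \in msupp f /\
  (forall m, m \in msupp f -> m != LM f -> grevlex_lt m (LM f)).
Proof.
rewrite -msupp_eq0 /LM; elim: (msupp f) => [//|a s IH] _.
rewrite big_cons /grevlex_max.
have [->|/IH [Hin Hmax]] := eqVneq s [::].
  rewrite big_nil; have -> : grevlex_lt a 0%MM = false.
    rewrite /grevlex_lt mdeg0 ltn0 mdeg_eq0 /=.
    by apply/andP => -[/eqP -> /existsP[i]]; rewrite ltnn.
  by split=> [|m]; rewrite inE => // ->.
set M := bigop.body _ _ _ in Hin Hmax *.
have [aM|NaM] := boolP (grevlex_lt a M).
  by split=> [|m]; rewrite inE ?Hin ?orbT// => /orP[/eqP ->|/Hmax].
split=> [|m]; rewrite inE ?eqxx//; case: (eqVneq m a) => //= ma ms _.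
have Ma : M = a \/ grevlex_lt M a.
  have [|/grevlex_lt_total] := eqVneq M a; first by left.
  by rewrite (negPf NaM) orbF; right.
case: (eqVneq m M) => [mM|/(Hmax _ ms) mM].
  by rewrite mM; case: Ma => // e; move: ma; rewrite mM e eqxx.
by case: Ma => [<- //|]; apply: grevlex_lt_trans.
Qed.

Inductive algebra_gen (F : fieldType) (R : lalgType F) (S : R -> Prop) :
  R -> Prop :=
| algebra_gen_in u : S u -> algebra_gen S u
| algebra_gen_scalar (c : F) : algebra_gen S c%:A
| algebra_gen_add u v :
    algebra_gen S u -> algebra_gen S v -> algebra_gen S (u + v)
| algebra_gen_mul u v :
    algebra_gen S u -> algebra_gen S v -> algebra_gen S (u * v).

Inductive linear_span (F : fieldType) (U : lmodType F) (S : U -> Prop) :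
  U -> Prop :=
| linear_span0 : linear_span S 0
| linear_spanD (c : F) u v :
    S u -> linear_span S v -> linear_span S (c *: u + v).

Section Sagbi.

Variables (F : fieldType) (n : nat).
Implicit Types (A B : {mpoly F[n]} -> Prop) (f : {mpoly F[n]}).

Definition lead_monomials B f : Prop :=
  exists b, [/\ B b, b != 0 & f = 'X_[LM b]].

(* The product of two lead monomials is a lead monomial, so that for a
   subalgebra A this linear span is a subalgebra. *)
Definition lead_term_algebra A : {mpoly F[n]} -> Prop :=
  linear_span (lead_monomials A).

Definition is_SAGBI_basis B A : Prop :=
  (forall b, B b -> A b) /\
  (forall f, algebra_gen (lead_monomials B) f <-> lead_term_algebra A f).

(* A[x^-1], inside the fraction field of F[V]. *)
Definition localization A (x : {mpoly F[n]}) (u : {fraction {mpoly F[n]}}) :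
  Prop := exists a k, A a /\ u = tofrac a / tofrac x ^+ k.

(* mxpoly.integralOver wants the base ring as a type; A is only a predicate. *)
Definition integral_over A f : Prop :=
  exists q : {poly {mpoly F[n]}},
    [/\ q \is monic, forall i, A q`_i & root q f].

End Sagbi.

Section Invariants.

(* V is the space of column vectors 'cV[F]_n with the left action rG g *m v;
   hence V^* is the space of row vectors 'rV[F]_n with the right action
   u *m rG g.  The rows of an invertible matrix B form a basis of V^*, and
   F[V] is {mpoly F[n]}, where 'X_i stands for the basis element row i B. *)
Variables (F : fieldType) (gT : finGroupType) (G : {group gT}) (n : nat).
Variables (rG : mx_representation F G n) (B : 'M[F]_n).

(* The embedding of V^* into F[V]; u *m invmx B are the coordinates of u in the
   basis B. *)
Definition linear_form (u : 'rV[F]_n) : {mpoly F[n]} :=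
  \sum_(j < n) (u *m invmx B) 0 j *: 'X_j.

Definition poly_act (g : gT) (f : {mpoly F[n]}) : {mpoly F[n]} :=
  f \mPo [tuple linear_form (row i B *m rG g) | i < n].

Definition invariant_poly (f : {mpoly F[n]}) : Prop :=
  forall g, g \in G -> poly_act g f = f.

End Invariants.

(* Main.v *)
(* No monomial divisible by x is a product of the LM(f_i) alone, so the SAGBI
   property lifts LM(x h), for x h in A, to an element x a' of A with a' in A.
   Subtracting a multiple of it lowers the lead monomial and keeps
   divisibility by x; by induction A meets x F[V] exactly in x A.  Every
   invariant h satisfies x^k h in A for some k, and one cancels x k times. *)
Require Import Defs.
From HB Require Import structures.
From mathcomp Require Import all_boot all_order all_algebra.
From mathcomp Require Import all_fingroup all_solvable mxrepresentation.
From mathcomp Require Import fraction mpoly.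

Set Implicit Arguments.
Unset Strict Implicit.
Unset Printing Implicit Defensive.

Local Open Scope ring_scope.

Import GRing.Theory.

(** * Lead monomials for the graded reverse lexicographic order *)

Lemma grevlex_lt_mdeg n (a b : 'X_{1..n}) :
  grevlex_lt a b -> (mdeg a <= mdeg b)%N.
Proof. by case/orP => [/ltnW//|/andP[/eqP->]]. Qed.

Lemma grevlex_lt_add2r n (c a b : 'X_{1..n}) :
  grevlex_lt (a + c)%MM (b + c)%MM = grevlex_lt a b.
Proof.
rewrite /grevlex_lt !mdegD ltn_add2r eqn_add2r; congr (_ || _ && _).
apply: eq_existsb => i; rewrite !mnmDE ltn_add2r; congr (_ && _).
by apply: eq_forallb => j; rewrite !mnmDE eqn_add2r.
Qed.

Section LeadMonomial.

Variables (F : fieldType) (n : nat).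
Implicit Types (f g h : {mpoly F[n]}) (m : 'X_{1..n}).

Lemma LM_eq f m : m \in msupp f ->
  (forall k, k \in msupp f -> k != m -> grevlex_lt k m) -> LM f = m.
Proof.
move=> mf mmax; have f0 : f != 0 by apply: contraTneq mf => ->; rewrite msupp0.
have [Lf Lmax] := LM_max f0; apply/eqP; apply: contraT => neq.
have := grevlex_lt_trans (mmax _ Lf neq) (Lmax _ mf _).
by rewrite grevlex_lt_irr => -> //; rewrite eq_sym.
Qed.

Lemma LM_X m : LM ('X_[m] : {mpoly F[n]}) = m.
Proof.
by apply: LM_eq => [|k]; rewrite msuppX inE // => /eqP ->; rewrite eqxx.
Qed.

Lemma LM_1 : LM (1 : {mpoly F[n]}) = 0%MM.
Proof. by rewrite -mpolyX0 LM_X. Qed.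

(** The order is compatible with addition of exponents, so any other pair of support monomials has a
    strictly smaller sum. Hence nothing cancels the product of the lead terms. *)
Lemma LM_M f g : f != 0 -> g != 0 -> LM (f * g) = (LM f + LM g)%MM.
Proof.
move=> f0 g0; have [Lf maxf] := LM_max f0; have [Lg maxg] := LM_max g0.
have lt_sum a b : a \in msupp f -> b \in msupp g ->
    (a != LM f) || (b != LM g) -> grevlex_lt (a + b)%MM (LM f + LM g)%MM.
  move=> af bg; have [->|/(maxf _ af) ltf _] := eqVneq a (LM f).
    by move=> /(maxg _ bg); rewrite ![(LM f + _)%MM]addmC grevlex_lt_add2r.
  have ltfg : grevlex_lt (a + LM g)%MM (LM f + LM g)%MM.
    by rewrite grevlex_lt_add2r.
  have [-> //|/(maxg _ bg) ltg] := eqVneq b (LM g).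
  by apply: grevlex_lt_trans ltfg; rewrite ![(a + _)%MM]addmC grevlex_lt_add2r.
apply: LM_eq => [|k /msuppM_le /allpairsP[[a b] /= [af bg ->]] neq]; last first.
  by apply: lt_sum => //; rewrite -negb_and; apply: contra neq => /andP[/eqP-> /eqP->].
(* Split [f] into its lead term and a remainder. The lead term contributes the product of the two
   lead coefficients; the remainder contributes 0, as its support misses [LM f]. *)
rewrite mcoeff_msupp -[f in f * g](subrK (f@_(LM f) *: 'X_[LM f])) mulrDl mcoeffD.
rewrite -scalerAl mcoeffZ ['X_[_] * g]mulrC mcoeffMX.
rewrite (_ : mcoeff _ _ = 0) ?add0r; last first.
  apply/eqP; rewrite mcoeff_eq0; apply/negP => /msuppM_le.
  case/allpairsP=> -[a b] /= [ar bg eab].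
  have aL : a != LM f.
    apply: contraTneq ar => ->.
    by rewrite mcoeff_msupp mcoeffB mcoeffZ mcoeffX eqxx mulr1 subrr eqxx.
  have af : a \in msupp f.
    have := msuppB_le ar; rewrite mem_cat => /orP[//|/msuppZ_le].
    by rewrite msuppX inE (negPf aL).
  have := lt_sum _ _ af bg; rewrite aL => /(_ isT).
  by rewrite -eab grevlex_lt_irr.
by rewrite mulf_neq0 // -mcoeff_msupp.
Qed.

Lemma LM_subr f g : f != 0 -> g != 0 -> LM f = LM g ->
  let r := f - (f@_(LM f) / g@_(LM g)) *: g in
  r != 0 -> grevlex_lt (LM r) (LM f).
Proof.
move=> f0 g0 efg r r0; have [Lf maxf] := LM_max f0; have [Lg maxg] := LM_max g0.
have [Lr _] := LM_max r0.
have Lrf : LM r != LM f.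
  apply: contraTneq Lr => ->; rewrite mcoeff_msupp negbK mcoeffB mcoeffZ.
  by rewrite efg divfK ?subrr // -mcoeff_msupp.
move: Lr => /msuppB_le; rewrite mem_cat => /orP[/maxf->//|/msuppZ_le/maxg].
by rewrite -efg => ->.
Qed.

(* Below a fixed monomial there are only finitely many others, since grevlex
   compares degrees first. *)
Lemma LM_ind (P : {mpoly F[n]} -> Prop) :
  P 0 ->
  (forall f, f != 0 ->
     (forall g, g != 0 -> grevlex_lt (LM g) (LM f) -> P g) -> P f) ->
  forall f, P f.
Proof.
move=> P0 IH f; have [->//|] := eqVneq f 0.
have [N] := ubnP (mdeg (LM f)).
pose below m := [pred b : 'X_{1..n < N} | grevlex_lt b m].
have [k] := ubnP #|below (LM f)|; elim: k => // k IHk in f *.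
move=> ltk ltN f0; apply: IH => // g g0 gf; have gN : (mdeg (LM g) < N)%N.
  exact: leq_ltn_trans (grevlex_lt_mdeg gf) ltN.
apply: IHk => //; rewrite ltnS in ltk; apply: leq_trans ltk.
apply: proper_card; apply/properP; split.
  by apply/subsetP => b; rewrite !inE => /grevlex_lt_trans; apply.
by exists (BMultinom gN); rewrite !inE //= grevlex_lt_irr.
Qed.

End LeadMonomial.

(** * Closure properties of generated subalgebras *)

Section AlgebraGen.

Variables (F : fieldType) (R : lalgType F) (S : R -> Prop).

Lemma algebra_gen1 : algebra_gen S 1.
Proof. by rewrite -[1]scale1r; apply: algebra_gen_scalar. Qed.

Lemma algebra_genZ c u : algebra_gen S u -> algebra_gen S (c *: u).
Proof.
by move=> Su; rewrite -mulr_algl; apply: algebra_gen_mul => //; apply: algebra_gen_scalar.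
Qed.

Lemma algebra_genB u v : algebra_gen S u -> algebra_gen S v -> algebra_gen S (u - v).
Proof.
move=> Su Sv; apply: algebra_gen_add => //.
by rewrite -scaleN1r; apply: algebra_genZ.
Qed.

End AlgebraGen.

(** * Division by a variable in a subalgebra with a SAGBI basis *)

Section SagbiDivision.

Variables (F : fieldType) (n : nat) (i : 'I_n) (B : {mpoly F[n]} -> Prop).
Hypothesis B_lead : forall b, B b -> b = 'X_i \/ LM b i = 0%N.

Let A := algebra_gen B.

(** The last clause strengthens being a lead monomial of [A]: if the variable divides [m], the lift
    can be divided by it inside [A]. In this form the property passes to products. *)
Let lifts (m : 'X_{1..n}) := exists a : {mpoly F[n]},
  [/\ A a, a != 0, LM a = m & (0 < m i)%N -> exists2 a', A a' & a = 'X_i * a'].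

Lemma lifts0 : lifts 0%MM.
Proof.
exists 1; split; [exact: algebra_gen1 | exact: oner_neq0 | exact: LM_1 |].
by rewrite mnm0E.
Qed.

Lemma liftsD m1 m2 : lifts m1 -> lifts m2 -> lifts (m1 + m2)%MM.
Proof.
move=> [a [Aa a0 <- da]] [b [Ab b0 <- db]]; exists (a * b).
split; [exact: algebra_gen_mul | exact: mulf_neq0 | exact: LM_M |].
(* A variable dividing a product of monomials divides one of them; the quotient comes from the lift
   of that factor. *)
rewrite mnmDE addn_gt0 => /orP[/da[a' Aa' ->]|/db[b' Ab' ->]].
  by exists (a' * b); [exact: algebra_gen_mul | rewrite mulrA].
by exists (a * b'); [exact: algebra_gen_mul | rewrite mulrCA].
Qed.

Lemma lifts_generator b : B b -> b != 0 -> lifts (LM b).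
Proof.
move=> Bb b0; exists b; split=> //; first exact: algebra_gen_in.
(* The variable is itself times 1; for every other generator the divisibility clause is vacuous. *)
by case: (B_lead Bb) => [->|->//] _; exists 1; [exact: algebra_gen1 | rewrite mulr1].
Qed.

(** Stated for all support monomials so that induction on the generation of [u] goes through:
    cancellation in a sum can only shrink the support. *)
Lemma msupp_lead_lifts u m :
  algebra_gen (lead_monomials B) u -> m \in msupp u -> lifts m.
Proof.
move=> Au; elim: Au m => {u} [u [b [Bb b0 ->]] m|c m|u v _ IHu _ IHv m|u v _ IHu _ IHv m].
- by rewrite msuppX inE => /eqP ->; apply: lifts_generator.
- by move=> /msuppZ_le; rewrite msupp1 inE => /eqP ->; apply: lifts0.
- by move=> /msuppD_le; rewrite mem_cat => /orP[/IHu|/IHv].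
- by move=> /msuppM_le/allpairsP[[m1 m2] /= [/IHu l1 /IHv l2 ->]]; apply: liftsD.
Qed.

Lemma SAGBI_divX h : is_SAGBI_basis B A -> A ('X_i * h) -> A h.
Proof.
move=> [_ sagbi]; have X0 : 'X_i != 0 :> {mpoly F[n]} by rewrite -msupp_eq0 msuppX.
elim/LM_ind: h => [_|h h0 IH AXh].
  by rewrite -(scale0r 1); apply: algebra_gen_scalar.
have Xh0 : 'X_i * h != 0 by rewrite mulf_neq0.
have [a [Aa a0 La div_a]] : lifts (LM ('X_i * h)).
  (* The monomial itself lies in the lead term algebra, as a span with one term, hence by the SAGBI
     property in the algebra generated by the lead monomials of [B]. *)
  apply: (@msupp_lead_lifts 'X_[LM ('X_i * h)]); last by rewrite msuppX inE.
  apply/sagbi; rewrite -[X in lead_term_algebra _ X]scale1r -[_ *: _]addr0.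
  by apply: linear_spanD (linear_span0 _); exists ('X_i * h).
have [|a' Aa' ea] := div_a; first by rewrite LM_M // LM_X mnmDE mnm1E eqxx.
have a'0 : a' != 0 by apply: contraNneq a0; rewrite ea => ->; rewrite mulr0.
(* [c] makes the lead terms of ['X_i * h] and [c *: a] cancel. As [a = 'X_i * a'], the difference is
   again a multiple of ['X_i], with cofactor [r]. *)
pose c := ('X_i * h)@_(LM ('X_i * h)) / a@_(LM a).
pose r := h - c *: a'; have eXr : 'X_i * r = 'X_i * h - c *: a.
  by rewrite mulrBr ea -scalerAr.
have -> : h = r + c *: a' by rewrite subrK.
apply: algebra_gen_add; last exact: algebra_genZ.
have [->|r0] := eqVneq r 0.
  by rewrite -(scale0r 1); apply: algebra_gen_scalar.
apply: IH => //; last first.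
  by rewrite eXr; apply: algebra_genB => //; apply: algebra_genZ.
(* The lead monomial drops after multiplication by ['X_i]; cancelling the common summand [LM 'X_i]
   gives the drop from [h] to [r]. *)
have := @LM_subr _ _ ('X_i * h) a Xh0 a0 (esym La).
rewrite /= -/c -eXr mulf_neq0 // => /(_ isT).
by rewrite !LM_M // ![(LM 'X_i + _)%MM]addmC grevlex_lt_add2r.
Qed.

Lemma SAGBI_divXn k h : is_SAGBI_basis B A -> A ('X_i ^+ k * h) -> A h.
Proof.
move=> sagbi; elim: k h => [|k IH] h; first by rewrite mul1r.
by rewrite exprSr -mulrA => /IH /(SAGBI_divX sagbi).
Qed.

End SagbiDivision.

(** * The group action and its invariants *)

Section Invariants.

Variables (F : fieldType) (gT : finGroupType) (G : {group gT}) (n : nat).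
Variables (rG : mx_representation F G n) (Y : 'M[F]_n).

Lemma poly_act_X g i : poly_act rG Y g 'X_i = linear_form Y (row i Y *m rG g).
Proof. by rewrite /poly_act comp_mpolyXU -tnth_nth tnth_mktuple. Qed.

Lemma linear_form_row i : Y \in unitmx -> linear_form Y (row i Y) = 'X_i.
Proof.
move=> uY; rewrite /linear_form -row_mul mulmxV // row1 (bigD1 i) //=.
rewrite big1 => [|j ji]; rewrite mxE eqxx /=; last by rewrite (negPf ji) scale0r.
by rewrite eqxx scale1r addr0.
Qed.

Lemma invariant_poly_X i : Y \in unitmx ->
  (row i Y <= rfix_mx rG G)%MS -> invariant_poly rG Y 'X_i.
Proof.
move=> uY /rfix_mxP fixi g gG.
by rewrite poly_act_X fixi // linear_form_row.
Qed.

(** Each [g] acts by substitution, an algebra morphism, so being fixed by [g] is inherited from the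
    generators. *)
Lemma invariant_poly_algebra_gen (S : {mpoly F[n]} -> Prop) h :
  (forall b, S b -> invariant_poly rG Y b) ->
  algebra_gen S h -> invariant_poly rG Y h.
Proof.
move=> Sinv Sh g gG; rewrite /poly_act.
elim: Sh => {h} [u /Sinv/(_ g gG)//|c|u v _ IHu _ IHv|u v _ IHu _ IHv].
- by rewrite comp_mpolyZ comp_mpoly1.
- by rewrite comp_mpolyD IHu IHv.
- by rewrite rmorphM /= IHu IHv.
Qed.

End Invariants.

(** Two subalgebras are compared as predicates, only up to pointwise equivalence; monotonicity, used
    in both directions, carries the SAGBI property from one to the other. *)
Lemma lead_term_algebra_ext (F : fieldType) n (A A' : {mpoly F[n]} -> Prop) h :
  (forall u, A u -> A' u) -> lead_term_algebra A h -> lead_term_algebra A' h.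
Proof.
move=> AA'; elim=> [|c u v [b [Ab b0 ->]] _ IH]; first exact: linear_span0.
by apply: linear_spanD => //; exists b; split=> //; apply: AA'.
Qed.

(* The dimension of V is m.+1; the basis x, y_1, ..., y_m of V^* consists of the
   rows 0, 1, ..., m of Y. *)
Theorem theorem2p1 (p : nat) (gT : finGroupType) (G : {group gT})
    (F : fieldType) (m : nat) (rG : mx_representation F G m.+1)
    (Y : 'M[F]_m.+1) (l : nat) (f : 'I_l -> {mpoly F[m.+1]})
    (p_prime : prime p) (pG : (p.-group G)%g) (charF : p \in [pchar F])
    (Y_basis : Y \in unitmx)
    (x_fixed : (row ord0 Y <= rfix_mx rG G)%MS)
    (y_orbit : forall (i : 'I_m.+1) (g : gT), (0 < i)%N -> g \in G ->
       (row i Y *m rG g <= \sum_(j < m.+1 | (j <= i)%N) <<row j Y>>)%MS)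
    (f_invariant : forall i, invariant_poly rG Y (f i))
    (f_homog : forall i, exists d : nat, f i \is d.-homog)
    (f_lead : forall i, LM (f i) ord0 = 0%N) :
  let x : {mpoly F[m.+1]} := 'X_ord0 in
  let B := fun b : {mpoly F[m.+1]} => b = x \/ exists i, b = f i in
  let A := algebra_gen B in
  (forall u, localization A x u <-> localization (invariant_poly rG Y) x u) ->
  is_SAGBI_basis B A ->
  (forall h, invariant_poly rG Y h -> integral_over A h) ->
  (forall h, A h <-> invariant_poly rG Y h) /\ is_SAGBI_basis B (invariant_poly rG Y).
Proof.
move=> x B A locA sagbi _.
have B_inv b : B b -> invariant_poly rG Y b.
  by case=> [->|[i ->]//]; apply: invariant_poly_X.
have B_lead b : B b -> b = 'X_ord0 \/ LM b ord0 = 0%N.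
  by case=> [->|[i ->]]; [left | right].
have AE h : A h <-> invariant_poly rG Y h.
  split=> [|inv_h]; first exact: invariant_poly_algebra_gen.
  (* View [h] as the fraction with denominator [x ^+ 0]; the equality of localizations rewrites it
     as [a / x ^+ k] with [a] in [A]. *)
  have /locA[a [k [Aa ea]]] : localization (invariant_poly rG Y) x (tofrac h).
    by exists h, 0%N; rewrite expr0 divr1.
  apply: (SAGBI_divXn (k := k) B_lead sagbi).
  have Xk0 : x ^+ k != 0 by rewrite expf_neq0 // -msupp_eq0 msuppX.
  suff -> : 'X_ord0 ^+ k * h = a by [].
  (* The polynomial ring embeds in its fraction field, so the denominator can be cleared there. *)
  apply/eqP; rewrite -tofrac_eq tofracM tofracXn ea mulrC divfK //.
  by rewrite -tofracXn tofrac_eq0.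
split=> //; case: sagbi => BA sagbi; split=> [b /BA /AE//|h].
rewrite sagbi; split; apply: lead_term_algebra_ext => u /AE //.
Qed.
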